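(* Let $K$ be a number field and $y=\sum_{n=0}^\infty \mathbf{a}(n)x^n\in K[[x]]$. Then $N_\mathfrak{p}(\mathbf{a}_\mathfrak{p})$ and $N_\mathfrak{p}^f(\mathbf{a}_\mathfrak{p})$ are bounded independently of $\mathfrak{p}$ (as $\mathfrak{p}$ ranges over the primes of $K$ for which $\mathbf{a}_\mathfrak{p}$ is defined) if and only if $y$ is a rational function whose finite poles are all simple and occur at roots of unity (a pole at $\infty$ may be of any order).
   Context: For a prime $\mathfrak{p}$ of $K$ with $v_\mathfrak{p}(\mathbf{a}(n))\ge0$ for all $n$, $\mathbf{a}_\mathfrak{p}$ denotes the reduction of $\mathbf{a}$ modulo $\mathfrak{p}$, a sequence in the residue field $k(\mathfrak{p})$. A DFAO consists of input alphabet, output alphabet, finite state set, initial state $q_0$, transition function $\delta$ (extended to words by $\delta(s,wa)=\delta(\delta(s,w),a)$) and output function $\tau$. For $b\ge2$ and $\Sigma_b=\{0,\dots,b-1\}$, a reverse-reading (resp. forward-reading) $b$-DFAO generates a sequence $\mathbf{c}$ if for every $n\ge0$ and every base-$b$ representation $w$ of $n$ (any number of leading zeros allowed), $\tau(\delta(q_0,w^R))=\mathbf{c}(n)$ (resp. $\tau(\delta(q_0,w))=\mathbf{c}(n)$), $w^R$ the reversed word; $N_b(\mathbf{c})$ (resp. $N_b^f(\mathbf{c})$) is the minimal number of states of such a DFAO (infinite if none exists). Write $N_\mathfrak{p}(\mathbf{a}_\mathfrak{p})=N_{|k(\mathfrak{p})|}(\mathbf{a}_\mathfrak{p})$ and 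$N^f_\mathfrak{p}(\mathbf{a}_\mathfrak{p})=N^f_{|k(\mathfrak{p})|}(\mathbf{a}_\mathfrak{p})$.
   Formalization: The formal theorem additionally assumes that the reduction of a modulo p is defined for infinitely many primes p of K; without this the claim fails, e.g. for y = e^x over Q, which has no such prime. *)

(* Defs.v *)
From HB Require Import structures.
From mathcomp Require Import all_boot all_order all_algebra all_field.
From mathcomp Require Import finmap.
From mathcomp Require Import boolp classical_sets cardinality constructive_ereal.

Set Implicit Arguments.
Unset Strict Implicit.
Unset Printing Implicit Defensive.

Import Order.TTheory GRing.Theory Num.Theory.
Local Open Scope ring_scope.

(* A (finite) prime of the number field K, given by its normalized discrete
   valuation v_p : K -> Z \cup {+oo}. *)
Record prime_of (K : fieldExtType rat) := PrimeOf {
  valuation :> K -> \bar int;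
  valuation_eqy : forall x, (valuation x == +oo%E) = (x == 0);
  valuation_neqNy : forall x, valuation x != -oo%E;
  valuationM : forall x y, valuation (x * y) = (valuation x + valuation y)%E;
  valuationD : forall x y,
    (Order.min (valuation x) (valuation y) <= valuation (x + y))%E;
  valuation_normalized : exists x, valuation x = 1%:E
}.

Section ResidueField.
Variables (K : fieldExtType rat) (p : prime_of K).

Lemma valuation1 : p 1 = 0%E.
Proof.
have := valuationM p 1 1; rewrite mulr1.
have := valuation_neqNy p 1; have := valuation_eqy p 1; rewrite oner_eq0.
case: (valuation p 1) => [r| |] //= _ _ [] /eqP.
by rewrite -subr_eq0 opprD addrA subrr add0r oppr_eq0 => /eqP ->.
Qed.

Lemma valuationN x : p (- x) = p x.
Proof.
suff pN1 : p (-1) = 0%E by rewrite -mulN1r valuationM pN1 add0e.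
have := valuationM p (-1) (-1); rewrite mulrNN mulr1 valuation1.
case: (valuation p (-1)) => [r| |] //= [] /esym/eqP.
by rewrite -mulr2n mulrn_eq0 /= => /eqP ->.
Qed.

Definition valuation_integral : {pred K} := [pred x | (0 <= p x)%E].

Fact valuation_integral_subring : subring_closed valuation_integral.
Proof.
split=> [|x y|x y]; rewrite !inE.
- by rewrite valuation1.
- move=> px py; apply: le_trans (valuationD p x (- y)).
  by rewrite valuationN le_min px.
- by move=> px py; rewrite valuationM adde_ge0.
Qed.
HB.instance Definition _ :=
  GRing.isSubringClosed.Build K valuation_integral valuation_integral_subring.

Record valuation_ring := ValuationRing {
  valuation_ring_val :> K;
  _ : valuation_ring_val \in valuation_integral
}.
HB.instance Definition _ := [isSub for valuation_ring_val].
HB.instance Definition _ := [Choice of valuation_ring by <:].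
HB.instance Definition _ := [SubChoice_isSubComNzRing of valuation_ring by <:].

Definition max_ideal : valuation_ring -> bool := fun x => (0 < p (val x))%E.

Fact max_ideal_closed : idealr_closed max_ideal.
Proof.
have inE' x : (x \in max_ideal) = (0 < p (val x))%E by [].
split=> [||a x y]; rewrite !inE' /=.
- have /eqP -> : p 0 == +oo%E by rewrite valuation_eqy.
  exact: ltry.
- by rewrite valuation1 ltxx.
- move=> px py; apply: lt_le_trans (valuationD p _ _).
  rewrite lt_min py andbT valuationM.
  have pa : (0 <= p (val a))%E by exact: (valP a).
  exact: lt_le_trans px (leeDr _ pa).
Qed.
HB.instance Definition _ := isIdealr.Build valuation_ring max_ideal max_ideal_closed.

Definition residue_field := {ideal_quot (max_ideal : idealr valuation_ring)}.
HB.instance Definition _ := GRing.ComNzRing.on residue_field.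

(* The residue field of a number field is finite, so fset_set does not take
   its default value here. *)
Definition residue_card : nat := #|` fset_set [set: residue_field]|.

Definition reduction (a : nat -> K) (ha : forall n, (0 <= p (a n))%E) :
    nat -> residue_field :=
  fun n => \pi_residue_field%qT (ValuationRing (ha n)).
End ResidueField.

Record dfao (Sigma : finType) (Delta : Type) := DFAO {
  dfao_state : finType;
  dfao_init : dfao_state;
  dfao_trans : dfao_state -> Sigma -> dfao_state;
  dfao_out : dfao_state -> Delta
}.

Definition dfao_run Sigma Delta (A : dfao Sigma Delta) (w : seq Sigma) : Delta :=
  dfao_out (foldl (@dfao_trans _ _ A) (dfao_init A) w).

Section Automaticity.
Variables (b : nat) (Delta : Type).
Implicit Type A : dfao 'I_b Delta.

(* Words have the most significant digit first; the empty word represents 0. *)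
Definition word_value (w : seq 'I_b) : nat :=
  foldl (fun m (d : 'I_b) => m * b + d)%N 0%N w.

Definition generates_reverse A (c : nat -> Delta) : Prop :=
  forall n (w : seq 'I_b), word_value w = n -> dfao_run A (rev w) = c n.

Definition generates_forward A (c : nat -> Delta) : Prop :=
  forall n (w : seq 'I_b), word_value w = n -> dfao_run A w = c n.

Definition min_states (generates : dfao 'I_b Delta -> (nat -> Delta) -> Prop)
    (c : nat -> Delta) : \bar int :=
  let has_size m := exists2 A, generates A c & #|dfao_state A| = m in
  if pselect (exists m, `[< has_size m >]) is left h
  then (ex_minn h)%:Z%:E else +oo%E.

Definition nb_states : (nat -> Delta) -> \bar int := min_states generates_reverse.
Definition nb_states_fwd : (nat -> Delta) -> \bar int := min_states generates_forward.
End Automaticity.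

(* The power series Q * (\sum_n a n X^n) is the polynomial P. *)
Definition expands_to (R : nzRingType) (a : nat -> R) (P Q : {poly R}) : Prop :=
  forall n, \sum_(i < n.+1) Q`_i * a (n - i)%N = P`_n.

(* In lowest terms the finite poles of P / Q are the roots of Q in extensions
   of K, and the order of a pole is its multiplicity as a root of Q. *)
Definition rational_simple_poles_at_unity_roots (K : fieldType) (a : nat -> K) :
    Prop :=
  exists P Q : {poly K}, [/\ Q != 0, coprimep P Q, expands_to a P Q
    & forall (L : fieldType) (f : {rmorphism K -> L}) (z : L),
        root (map_poly f Q) z ->
        mup z (map_poly f Q) = 1%N /\ exists2 n, (0 < n)%N & n.-unity_root z].

(* Main.v *)
(* Forward direction. A bounded number of states bounds the number of values of
   every reduction, and distinct values in K stay distinct modulo almost every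
   prime, so [a] has a finite range. Hence reduction modulo almost every prime is
   injective on the values of [a], and [a] itself is generated by automata in two
   multiplicatively independent bases; by Cobham's theorem it is eventually
   periodic. Conversely, an eventually periodic sequence is generated in every
   base, in both reading directions, by an automaton whose size depends only on
   the period and the preperiod. Finally, [a] is eventually periodic if and only
   if its series is a fraction whose denominator divides some X^N - 1. *)
Require Import Defs.
From mathcomp Require Import all_boot all_order all_algebra all_field.
From mathcomp Require Import finmap.
From mathcomp Require Import boolp classical_sets functions cardinality constructive_ereal.
From mathcomp Require Import zify.

Set Implicit Arguments.
Unset Strict Implicit.
Unset Printing Implicit Defensive.

Import Order.TTheory GRing.Theory Num.Theory.
Local Open Scope ring_scope.

(** * Cobham's theorem *)

Lemma noninjective_of_card_lt (T T' : finType) (f : T -> T') :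
  (#|T'| < #|T|)%N -> exists x y, x != y /\ f x = f y.
Proof.
move=> lt_T'T; have /injectivePn[x [y ne_xy eq_f]] : ~~ injectiveb f.
  apply/negP => /injectiveP/leq_card; rewrite leqNgt lt_T'T //.
by exists x, y.
Qed.

(* The numbers [k ^ i / l ^ (trunc_log l (k ^ i))] lie in [[1, l)]; two of them
   differ by less than [1 / N], and their quotient is [k ^ d / l ^ e]. *)
Lemma power_ratio_near_one (k l N : nat) : (1 < k)%N -> (1 < l)%N -> (0 < N)%N ->
  exists d e, [/\ (0 < d)%N, (0 < e)%N,
    (N * (k ^ d - l ^ e) <= l ^ e)%N & (N * (l ^ e - k ^ d) <= l ^ e)%N].
Proof.
move=> k1 l1 N0.
pose j i := trunc_log l (k ^ i).
have jP i : (l ^ j i <= k ^ i < l ^ (j i).+1)%N.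
  by apply: trunc_log_bounds; rewrite // expn_gt0 ltnW.
have l0 i : (0 < l ^ i)%N by rewrite expn_gt0 ltnW.
have k0 i : (0 < k ^ i)%N by rewrite expn_gt0 ltnW.
(* The ratio [k ^ i / l ^ j i] lies in [1, l). Cutting that interval into pieces of length 1 / N
   leaves at most [N * l] buckets, one fewer than the indices tried. *)
have bucketP i : ((N * k ^ i) %/ l ^ j i < N * l)%N.
  rewrite ltn_divLR // -mulnA -expnS ltn_pmul2l //.
  by case/andP: (jP i).
have [|i1 [i2 [ne_i eq_b]]] :=
  @noninjective_of_card_lt 'I_(N * l).+1 'I_(N * l) (fun i => Ordinal (bucketP i)).
  by rewrite !card_ord.
wlog lt_i : i1 i2 ne_i eq_b / (i1 < i2)%N.
  move=> H; case: (ltngtP i1 i2) => [lt_i|lt_i|/val_inj eq_i].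
  - exact: H eq_b lt_i.
  - by apply: H (esym eq_b) lt_i; rewrite eq_sym.
  - by rewrite eq_i eqxx in ne_i.
move/(congr1 val): eq_b => /=; set t := (_ %/ _)%N => eq_t.
have le_j : (j i1 <= j i2)%N.
  by apply: leq_trunc_log; rewrite leq_exp2l // ltnW.
have [b1 b2] : (t * l ^ j i1 <= N * k ^ i1 < t.+1 * l ^ j i1)%N /\
               (t * l ^ j i2 <= N * k ^ i2 < t.+1 * l ^ j i2)%N.
  split; last rewrite eq_t.
    by rewrite leq_divM /= ltn_ceil.
  by rewrite leq_divM /= ltn_ceil.
have [lj1 _] := andP (jP i1).
have kE : (k ^ i2 = k ^ i1 * k ^ (i2 - i1))%N by rewrite -expnD subnKC // ltnW.
have lE : (l ^ j i2 = l ^ j i1 * l ^ (j i2 - j i1))%N by rewrite -expnD subnKC.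
move: (subn_gt0 i1 i2) kE lE; rewrite lt_i.
set d := (i2 - i1)%N; set e := (j i2 - j i1)%N => d0 kE lE.
have := k0 i1; have := l0 (j i1); have := l0 e.
move: b1 b2 lj1; rewrite kE lE.
set A := (k ^ i1)%N; set B := (l ^ j i1)%N => b1 b2 leBA le0 B0 A0.
have [/andP[b1l b1r] /andP[b2l b2r]] := (b1, b2).
(* Both [N * A * l ^ e] and [N * A * k ^ d] lie between [t * B * l ^ e] and [t.+1 * B * l ^ e], an
   interval of length [B * l ^ e], at most [A * l ^ e]. Dividing their difference by [A] gives [up]
   and [dn]. *)
have h1 : (t * B * l ^ e <= N * A * l ^ e)%N by rewrite leq_mul2r b1l orbT.
have h2 : (N * A * l ^ e < t.+1 * B * l ^ e)%N by rewrite ltn_mul2r le0.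
have h3 : (B * l ^ e <= A * l ^ e)%N by rewrite leq_mul2r leBA orbT.
have up : (N * (k ^ d - l ^ e) < l ^ e)%N.
  rewrite -(ltn_pmul2l A0) mulnA mulnBr; lia.
have dn : (N * (l ^ e - k ^ d) < l ^ e)%N.
  rewrite -(ltn_pmul2l A0) mulnA mulnBr; lia.
exists d, e; split; [exact: d0| |exact: ltnW|exact: ltnW].
(* The strict bound [up] rules out e = 0: it would read N (k^d - 1) < 1, while k^d is at least 2. *)
rewrite lt0n; apply/eqP => e0; move: up; apply/negP.
by rewrite e0 expn0 -leqNgt muln_gt0 N0 subn_gt0 -(exp1n d) ltn_exp2r.
Qed.

(** Each value taken at least twice contributes the place of a second occurrence; a value taken once
    is avoided by going past that occurrence. [B] is the maximum over the finitely many values. *)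
Lemma repeated_values (S : finType) (s : nat -> S) :
  exists B, forall y, (B <= y)%N ->
    exists x0 y0, [/\ (x0 < y0 <= B)%N, s x0 = s y & s y0 = s y].
Proof.
have /fin_all_exists [b bP] : forall c : S, exists b, forall y, (b <= y)%N -> s y = c ->
    exists x0 y0, [/\ (x0 < y0 <= b)%N, s x0 = c & s y0 = c].
  move=> c; have [[x0 [y0 [lt_xy sx sy]]]|nex] :=
    pselect (exists x0 y0, [/\ (x0 < y0)%N, s x0 = c & s y0 = c]).
    by exists y0 => y _ _; exists x0, y0; rewrite lt_xy leqnn.
  have [[x sx]|nx] := pselect (exists x, s x = c).
    by exists x.+1 => y lt_xy sy; case: nex; exists x, y.
  by exists 0%N => y _ sy; case: nx; exists y.
exists (\max_c b c) => y le_y.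
have le_b c : (b c <= \max_c b c)%N := leq_bigmax c.
have [x0 [y0 [/andP[lt_xy le_y0] sx sy]]] := bP _ y (leq_trans (le_b _) le_y) erefl.
by exists x0, y0; split=> //; rewrite lt_xy (leq_trans le_y0).
Qed.

(** In the application [s x] is the state reached after the digits of [x] and [K] is a power of the
    base. Cobham's argument sees the automaton only through this property. *)
Definition determines_blocks (T S : Type) (s : nat -> S) (f : nat -> T) (K : nat) :=
  forall x y r, s x = s y -> (r < K)%N -> f (x * K + r)%N = f (y * K + r)%N.

Lemma determines_double_blocks (T S : Type) (s : nat -> S) (f : nat -> T) K x y r :
  determines_blocks s f K -> s x = s y -> s x.+1 = s y.+1 -> (r < 2 * K)%N ->
  f (x * K + r)%N = f (y * K + r)%N.
Proof.
move=> fs s0 s1 lt_r; case: (ltnP r K) => [|le_r]; first exact: fs.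
have rE : r = (K + (r - K))%N by rewrite subnKC.
have -> : (x * K + r = x.+1 * K + (r - K))%N by lia.
have -> : (y * K + r = y.+1 * K + (r - K))%N by lia.
by apply: fs => //; lia.
Qed.

Definition local_period (T : Type) (f : nat -> T) (p u v : nat) :=
  forall n, (u <= n)%N -> (n + p < v)%N -> f (n + p)%N = f n.

Lemma local_periodM (T : Type) (f : nat -> T) p u v m n :
  local_period f p u v -> (u <= n)%N -> (n + m * p < v)%N -> f (n + m * p)%N = f n.
Proof.
move=> fp le_un; elim: m => [|m IHm]; first by rewrite mul0n addn0.
rewrite mulSn (addnC p) addnA => lt_v; rewrite fp; [|lia|lia].
by apply: IHm; lia.
Qed.

(** Shifting by multiples of [q] brings any index to within [q] of [u], where there is still room
    for a shift by [p] below [v]. *)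
Lemma local_period_extend (T : Type) (f : nat -> T) p q u v w :
  (0 < q)%N -> local_period f p u v -> local_period f q u w ->
  (u + p + q <= v)%N -> local_period f p u w.
Proof.
move=> q0 fp fq le_v n le_un lt_w.
have nE : n = (u + (n - u) %% q + (n - u) %/ q * q)%N.
  by rewrite -addnA (addnC (_ %% _)%N) -divn_eq subnKC.
have lt_q : ((n - u) %% q < q)%N by rewrite ltn_mod.
move: lt_w; rewrite nE; set r := (_ %% _)%N in lt_q *; set t := (_ %/ _)%N => lt_w.
rewrite [in RHS](local_periodM fq); [|lia|lia].
have -> : (u + r + t * q + p = u + r + p + t * q)%N by lia.
rewrite (local_periodM fq); [|lia|lia].
by apply: fp; lia.
Qed.

(* Near [y K] and [y L] the shifts by [(y0 - x0) K] and by [(y0 - x0) L] both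
   preserve [f], so [f] has there the period [(y0 - x0) (K - L)], which is much
   smaller than [K]; these periods agree on overlapping intervals. *)
Lemma periodic_of_close_blocks (T Sk Sl : Type) (sk : nat -> Sk) (sl : nat -> Sl)
    (f : nat -> T) (K L B : nat) :
  (forall y, (B <= y)%N -> exists x0 y0, [/\ (x0 < y0 <= B)%N,
     sk x0 = sk y /\ sk x0.+1 = sk y.+1, sk y0 = sk y /\ sk y0.+1 = sk y.+1,
     sl x0 = sl y /\ sl x0.+1 = sl y.+1 & sl y0 = sl y /\ sl y0.+1 = sl y.+1]) ->
  determines_blocks sk f K -> determines_blocks sl f L ->
  (L < K)%N -> ((3 * B + 3) * (K - L) <= L)%N ->
  exists n0 p, (0 < p)%N /\ forall n, (n0 <= n)%N -> f (n + p)%N = f n.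
Proof.
move=> BP fk fl lt_LK le1.
have D0 : (0 < K - L)%N by rewrite subn_gt0.
have KD : (K = L + (K - L))%N by rewrite subnKC // ltnW.
move: (K - L)%N D0 KD le1 => D D0 KD le1.
have per y : (B <= y)%N -> exists p, (0 < p <= B * D)%N /\
    local_period f p (y * K) (y * K + (2 * L - B * D)).
  move=> /BP[x0 [y0 [/andP[lt_xy le_yB] [a1 a2] [b1 b2] [c1 c2] [d1 d2]]]].
  have leD : ((y0 - x0) * D <= B * D)%N.
    by rewrite leq_mul2r (leq_trans (leq_subr _ _) le_yB) orbT.
  have leD' : (x0 * D <= B * D)%N.
    by rewrite leq_mul2r (leq_trans (ltnW lt_xy) le_yB) orbT.
  have leDy : (y0 * D = (y0 - x0) * D + x0 * D)%N by rewrite -mulnDl subnK // ltnW.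
  have p0 : (0 < (y0 - x0) * D)%N by rewrite muln_gt0 subn_gt0 lt_xy.
  move: ((y0 - x0) * D)%N leD leDy p0 => p leD leDy p0.
  exists p; split; first by rewrite p0.
  move=> z le_z lt_z; have zE : z = (y * K + (z - y * K))%N by rewrite subnKC.
  move: lt_z; rewrite zE; set i := (z - y * K)%N => lt_i.
  have lt_iL : (i + p + B * D < 2 * L)%N by lia.
  (* With D = K - L and p = (y0 - x0) D, the chain is: y K + i + p to x0 K + i + p by [sk], which
     equals x0 L + i + y0 D; then to y0 L + i + y0 D = y0 K + i by [sl]; then to y K + i by [sk]. *)
  rewrite -addnA -(determines_double_blocks fk a1 a2); last by lia.
  have -> : (x0 * K + (i + p) = x0 * L + (i + y0 * D))%N by rewrite KD mulnDr; lia.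
  rewrite (determines_double_blocks (y := y0) fl); last by lia.
  - have -> : (y0 * L + (i + y0 * D) = y0 * K + i)%N by rewrite KD mulnDr; lia.
    by apply: (determines_double_blocks fk b1 b2); lia.
  - by rewrite c1.
  - by rewrite c2.
have [p [/andP[p0 le_p] perB]] := per B (leqnn _).
have perp y : (B <= y)%N -> local_period f p (y * K) (y * K + (2 * L - B * D)).
  elim: y => [|y IHy]; first by move: perB; rewrite leqn0 => + /eqP e; rewrite e.
  rewrite leq_eqVlt => /predU1P[<- //|le_y].
  have [q [/andP[q0 le_q] perq]] := per y.+1 (leqW le_y).
  (* The windows at y and y + 1 share 2 L - B D - K = L - (B + 1) D indices. The factor [3 * B + 3]
     makes this at least 2 B D, hence at least p + q. *)
  apply: (local_period_extend q0 (v := (y * K + (2 * L - B * D))%N) _ perq).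
    by move=> z le_z lt_z; apply: IHy => //; lia.
  by lia.
exists (B * K)%N, p; split=> // n le_n.
have K0 : (0 < K)%N by lia.
have := divn_eq n K; have : (n %% K < K)%N by rewrite ltn_mod.
set y := (n %/ K)%N; set r := (n %% K)%N => lt_r nE.
apply: (perp y); first by rewrite leq_divRL.
  by rewrite nE leq_addr.
by lia.
Qed.

(* After Krebs, "A more reasonable proof of Cobham's theorem": choose
   [k ^ m] and [l ^ n] close to each other. *)
Lemma cobham (T : Type) (f : nat -> T) (k l : nat)
    (Sk Sl : finType) (sk : nat -> Sk) (sl : nat -> Sl) :
  (1 < k)%N -> (1 < l)%N ->
  (forall m n, (0 < m)%N -> (0 < n)%N -> (k ^ m != l ^ n)%N) ->
  (forall m, determines_blocks sk f (k ^ m)) ->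
  (forall n, determines_blocks sl f (l ^ n)) ->
  exists n0 p, (0 < p)%N /\ forall n, (n0 <= n)%N -> f (n + p)%N = f n.
Proof.
move=> k1 l1 indep fk fl.
(* States at y + 1 are recorded too, because the windows used span two consecutive blocks. *)
have [B BP] := repeated_values (fun y => (sk y, sk y.+1, sl y, sl y.+1)).
(* Both bounds are relative to [l ^ n]. When [l ^ n] is the larger power, the extra unit in
   [(3 * B + 3).+1] pays for replacing it by [k ^ m]. *)
have [m [n [m0 n0 le1 le2]]] := @power_ratio_near_one k l (3 * B + 3).+1 k1 l1 (ltn0Sn _).
case: (ltngtP (l ^ n) (k ^ m)) => [lt_LK|lt_KL|/esym/eqP]; last first.
- by rewrite (negPf (indep _ _ m0 n0)).
- apply: (@periodic_of_close_blocks _ _ _ sl sk f (l ^ n) (k ^ m) B) => //.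
    move=> y /BP[x0 [y0 [lt_xy [e1 e2 e3 e4] [e5 e6 e7 e8]]]].
    by exists x0, y0.
  have E : ((3 * B + 3).+1 * (l ^ n - k ^ m) = (3 * B + 3) * (l ^ n - k ^ m) + (l ^ n - k ^ m))%N.
    by rewrite mulSn addnC.
  by lia.
- apply: (@periodic_of_close_blocks _ _ _ sk sl f (k ^ m) (l ^ n) B) => //.
    move=> y /BP[x0 [y0 [lt_xy [e1 e2 e3 e4] [e5 e6 e7 e8]]]].
    by exists x0, y0.
  by apply: leq_trans le1; rewrite leq_mul2r leqnSn orbT.
Qed.

(** * Automata *)

Lemma min_states_leP b (Delta : Type)
    (gen : dfao 'I_b Delta -> (nat -> Delta) -> Prop) c (C : nat) :
  (min_states gen c <= C%:Z%:E)%E <->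
  exists2 A, gen A c & (#|dfao_state A| <= C)%N.
Proof.
rewrite /min_states; case: pselect => [h|nh].
  case: ex_minnP => m /asboolP[A genA <-] min_m; rewrite lee_fin lez_nat.
  split=> [le_C|[A' genA' le_C]]; first by exists A.
  by apply: leq_trans (min_m _ _) le_C; apply/asboolP; exists A'.
split=> // -[A genA _]; case: nh; exists #|dfao_state A|.
by apply/asboolP; exists A.
Qed.

Lemma foldl_word_value b (m : nat) (w : seq 'I_b) :
  foldl (fun m (d : 'I_b) => m * b + d)%N m w = (m * b ^ size w + word_value w)%N.
Proof.
elim/last_ind: w => [|w d IHw]; first by rewrite /= muln1 addn0.
rewrite /word_value !foldl_rcons size_rcons IHw -/(word_value w).
by rewrite expnSr mulnA mulnDl addnA.
Qed.

Lemma word_value_cat b (w u : seq 'I_b) :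
  word_value (w ++ u) = (word_value w * b ^ size u + word_value u)%N.
Proof. by rewrite /word_value foldl_cat foldl_word_value. Qed.

Lemma word_value_cons b (d : 'I_b) (w : seq 'I_b) :
  word_value (d :: w) = (d * b ^ size w + word_value w)%N.
Proof. by rewrite -cat1s word_value_cat /word_value /= mul0n add0n. Qed.

Lemma word_of_size b j r : (r < b ^ j)%N ->
  exists2 w : seq 'I_b, size w = j & word_value w = r.
Proof.
elim: j r => [|j IHj] r; first by rewrite expn0 ltnS leqn0 => /eqP ->; exists [::].
case: b IHj => [|b] IHj; first by rewrite exp0n.
rewrite expnSr => lt_r; have [|w szw valw] := IHj (r %/ b.+1)%N.
  by rewrite ltn_divLR.
exists (rcons w (Ordinal (ltn_pmod r (ltn0Sn b)))); first by rewrite size_rcons szw.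
by rewrite -cats1 word_value_cat valw /= expn1 /word_value /= mul0n add0n -divn_eq.
Qed.

(** Let [s x] be the state after a chosen word for [x]. Appending the m-digit word of [r], padded
    with leading zeros, gives a word for x b^m + r, so its output depends only on [s x] and [r]. *)
Lemma forward_states b (Delta : Type) (c : nat -> Delta) (C : nat) : (1 < b)%N ->
  (nb_states_fwd b c <= C%:Z%:E)%E ->
  exists (S : finType) (s : nat -> S) (out : S -> Delta), [/\ (#|S| <= C)%N,
    forall n, c n = out (s n) & forall m, determines_blocks s c (b ^ m)].
Proof.
move=> b1 /min_states_leP[A genA leC].
have /choice[w wP] n : exists w : seq 'I_b, word_value w = n.
  by have [w _ wn] := word_of_size (ltn_expl n b1); exists w.
exists (dfao_state A), (fun n => foldl (@dfao_trans _ _ A) (dfao_init A) (w n)).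
exists (@dfao_out _ _ A); split=> // [n|m x y r /= eq_s lt_r].
  by rewrite -(genA n (w n)).
have [u szu valu] := word_of_size lt_r.
rewrite -(genA _ (w x ++ u)) -1?(genA _ (w y ++ u)) ?word_value_cat ?wP ?szu ?valu //.
by rewrite /dfao_run !foldl_cat eq_s.
Qed.

(* The representative in [0, n0 + N) of [n] for the semiring congruence
   identifying [n + N] with [n] for [n0 <= n]. *)
Definition eventual_mod (n0 N n : nat) : nat :=
  if (n < n0)%N then n else (n0 + (n - n0) %% N)%N.

Lemma eventual_mod_lt n0 N n : (0 < N)%N -> (eventual_mod n0 N n < n0 + N)%N.
Proof.
rewrite /eventual_mod => N0; case: ifP => [lt_n|_]; first exact: ltn_addr.
by rewrite ltn_add2l ltn_mod.
Qed.

Lemma eventual_modDM n0 N n t : (n0 <= n)%N ->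
  eventual_mod n0 N (n + t * N) = eventual_mod n0 N n.
Proof.
move=> le_n; rewrite /eventual_mod !ltnNge le_n (leq_trans le_n) ?leq_addr //=.
by rewrite -addnBAC // (addnC (n - n0)%N) modnMDl.
Qed.

Lemma eventual_modP n0 N n : exists t,
  n = (eventual_mod n0 N n + t * N)%N /\ (t = 0 \/ n0 <= eventual_mod n0 N n)%N.
Proof.
rewrite /eventual_mod; case: ltnP => [_|le_n].
  by exists 0%N; rewrite addn0; split=> //; left.
exists ((n - n0) %/ N)%N; rewrite leq_addr; split; last by right.
by rewrite -addnA (addnC (_ %% _)%N) -divn_eq subnKC.
Qed.

Lemma eventual_mod_addl n0 N m n :
  eventual_mod n0 N (eventual_mod n0 N m + n) = eventual_mod n0 N (m + n).
Proof.
have [t [E [t0|le_n0]]] := eventual_modP n0 N m; rewrite [in RHS]E;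
  first by rewrite t0 mul0n addn0.
by rewrite addnAC eventual_modDM // (leq_trans le_n0) // leq_addr.
Qed.

Lemma eventual_mod_mull n0 N m n :
  eventual_mod n0 N (eventual_mod n0 N m * n) = eventual_mod n0 N (m * n).
Proof.
have [t [E [t0|le_n0]]] := eventual_modP n0 N m; rewrite [in RHS]E;
  first by rewrite t0 mul0n addn0.
(* A positive factor keeps the product at least [n0], where shifts by multiples of [N] are
   invisible; the factor 0 must be treated apart. *)
case: n => [|n]; first by rewrite !muln0.
by rewrite mulnDl mulnAC eventual_modDM // (leq_trans le_n0) // leq_pmulr.
Qed.

Lemma eventual_mod_periodic n0 N (T : Type) (f : nat -> T) :
  (forall n, (n0 <= n)%N -> f (n + N)%N = f n) ->
  forall n, f (eventual_mod n0 N n) = f n.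
Proof.
move=> fN n; have [t [E [t0|le_n0]]] := eventual_modP n0 N n; rewrite [in RHS]E.
  by rewrite t0 mul0n addn0.
elim: t {E} => [|t IHt]; first by rewrite mul0n addn0.
by rewrite mulSn (addnC N) addnA fN // (leq_trans le_n0) // leq_addr.
Qed.

(** The automaton runs Horner's rule in the quotient semiring of [eventual_mod], whose size does not
    involve the base. *)
Lemma nb_states_fwd_periodic n0 N b (Delta : Type) (c : nat -> Delta) :
  (0 < N)%N -> (forall n, (n0 <= n)%N -> c (n + N)%N = c n) ->
  (nb_states_fwd b c <= (n0 + N)%N%:Z%:E)%E.
Proof.
move=> N0 cN; pose r n : 'I_(n0 + N) := Ordinal (eventual_mod_lt n0 n N0).
pose A := @DFAO 'I_b Delta 'I_(n0 + N)
  (r 0%N) (fun s d => r (s * b + d)%N) (fun s => c s).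
apply/min_states_leP; exists A; last by rewrite /= card_ord.
move=> _ w <-; suff -> : dfao_run A w = c (r (word_value w)).
  exact: eventual_mod_periodic.
rewrite /dfao_run /=.
suff -> : foldl (@dfao_trans _ _ A) (r 0%N) w = r (word_value w) by [].
elim/last_ind: w => [|w d IHw]; first by [].
rewrite foldl_rcons IHw /word_value foldl_rcons; apply: val_inj.
rewrite /= -eventual_mod_addl -[in RHS]eventual_mod_addl.
by rewrite eventual_mod_mull.
Qed.

Lemma nb_states_periodic n0 N b (Delta : Type) (c : nat -> Delta) :
  (0 < N)%N -> (forall n, (n0 <= n)%N -> c (n + N)%N = c n) ->
  (nb_states b c <= ((n0 + N) * (n0 + N))%N%:Z%:E)%E.
Proof.
move=> N0 cN; pose r n : 'I_(n0 + N) := Ordinal (eventual_mod_lt n0 n N0).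
(* The second component is the weight of the next digit. *)
pose A := @DFAO 'I_b Delta ('I_(n0 + N) * 'I_(n0 + N))%type (r 0%N, r 1%N)
  (fun s d => (r (s.1 + d * s.2)%N, r (s.2 * b)%N)) (fun s => c s.1).
apply/min_states_leP; exists A; last by rewrite /= card_prod card_ord.
move=> _ w <-; suff -> : dfao_run A (rev w) = c (r (word_value w)).
  exact: eventual_mod_periodic.
rewrite /dfao_run /=.
suff -> : foldl (@dfao_trans _ _ A) (r 0%N, r 1%N) (rev w) =
  (r (word_value w), r (b ^ size w)%N) by [].
elim: w => [|d w IHw]; first by [].
rewrite rev_cons foldl_rcons IHw; congr pair; apply: val_inj => /=.
  rewrite eventual_mod_addl word_value_cons.
  rewrite addnC -eventual_mod_addl mulnC eventual_mod_mull eventual_mod_addl.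
  by rewrite (mulnC d).
by rewrite eventual_mod_mull expnSr.
Qed.

(** * Power series *)

(** Truncating the series after degree [n] turns the convolution into a product of polynomials, to
    which ring identities apply. *)
Lemma expands_toE (R : nzRingType) (a : nat -> R) (P Q : {poly R}) :
  expands_to a P Q <->
  forall n m, (m <= n)%N -> (Q * \poly_(i < n.+1) a i)`_m = P`_m.
Proof.
have E n m : (m <= n)%N ->
    (Q * \poly_(i < n.+1) a i)`_m = \sum_(i < m.+1) Q`_i * a (m - i)%N.
  move=> le_mn; rewrite coefM; apply: eq_bigr => i _; rewrite coef_poly.
  by rewrite ltnS (leq_trans (leq_subr _ _) le_mn).
by split=> [aPQ n m /E -> //|H m]; rewrite -(E m m) // H.
Qed.

Lemma expands_toM (R : nzRingType) (a : nat -> R) (P Q U : {poly R}) :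
  expands_to a P Q -> expands_to a (U * P) (U * Q).
Proof.
move=> /expands_toE aPQ; apply/expands_toE => n m le_mn.
rewrite -mulrA !coefM; apply: eq_bigr => i _; rewrite aPQ //.
exact: leq_trans (leq_subr _ _) le_mn.
Qed.

(** A polynomial with nonzero constant term is not a zero divisor among power series: the
    coefficients of the other factor vanish one after the other. *)
Lemma expands_to_cancel (R : idomainType) (a : nat -> R) (P Q g : {poly R}) :
  g`_0 != 0 -> expands_to a (g * P) (g * Q) -> expands_to a P Q.
Proof.
move=> g0 /expands_toE aPQ; apply/expands_toE => n m le_mn.
apply/eqP; rewrite -subr_eq0 -coefB.
have {aPQ} : forall m, (m <= n)%N -> (g * (Q * \poly_(i < n.+1) a i - P))`_m = 0.
  by move=> i le_in; rewrite mulrBr coefB mulrA aPQ // subrr.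
move: (_ - P) => D gD0; elim/ltn_ind: m le_mn => m IHm le_mn.
have := gD0 m le_mn; rewrite coefM big_ord_recl subn0 big1 ?addr0.
  by move/eqP; rewrite mulf_eq0 (negPf g0).
move=> i _; rewrite (eqP (IHm _ _ _)) ?mulr0 // lift0; last first.
  by rewrite (leq_trans (leq_subr _ _)).
by rewrite ltn_subrL /= (leq_ltn_trans _ (ltn_ord i)).
Qed.

(** The product of the series with X^N - 1 has coefficient a(n) - a(n + N) at X^(n + N), a degree
    beyond that of [P]. *)
Lemma periodic_of_expansion (R : nzRingType) (a : nat -> R) (P : {poly R}) N :
  expands_to a P ('X^N - 1) -> forall n, (size P <= n)%N -> a (n + N)%N = a n.
Proof.
move=> /expands_toE aP n le_n; have := aP _ _ (leqnn (n + N)).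
rewrite mulrBl mul1r coefB coefXnM ltnNge leq_addl /= addnK !coef_poly.
rewrite ltnSn ltnS leq_addr [P`_ _]nth_default; last first.
  exact: leq_trans le_n (leq_addr _ _).
by move/eqP; rewrite subr_eq0 => /eqP.
Qed.

Lemma expansion_of_periodic (R : nzRingType) (a : nat -> R) N n0 :
  (forall n, (n0 <= n)%N -> a (n + N)%N = a n) ->
  exists P, expands_to a P ('X^N - 1).
Proof.
move=> aN; pose s n := \sum_(i < n.+1) ('X^N - 1 : {poly R})`_i * a (n - i)%N.
exists (\poly_(i < n0 + N) s i) => n; rewrite coef_poly -/(s n); case: ltnP => // le_n.
have -> : s n = (('X^N - 1) * \poly_(i < n.+1) a i)`_n.
  rewrite coefM; apply: eq_bigr => i _; by rewrite coef_poly ltnS leq_subr.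
rewrite mulrBl mul1r coefB coefXnM !coef_poly ltnSn ltnS leq_subr.
have le_N : (N <= n)%N := leq_trans (leq_addl _ _) le_n.
by rewrite ltnNge le_N /= -{2}(subnK le_N) aN ?subrr // leq_subRL // addnC.
Qed.

Lemma dvdp_Xnsub1 (F : fieldType) m n :
  ('X^m - 1 : {poly F}) %| 'X^(m * n) - 1.
Proof. by rewrite exprM [X in _ %| X]subrX1 dvdp_mulr. Qed.

Lemma exists_irreducible_factor (F : fieldType) (p : {poly F}) :
  (1 < size p)%N -> exists2 h, irreducible_poly h & h %| p.
Proof.
have [n] := ubnP (size p); elim: n p => // n IHn p; rewrite ltnS => le_p p1.
have [irr|nirr] := pselect (irreducible_poly p); first by exists p.
have p0 : p != 0 by rewrite -size_poly_gt0 ltnW.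
have [d [d1 dp ndp]] : exists d : {poly F}, [/\ size d != 1%N, d %| p & ~~ (d %= p)].
  apply: contrapT => H; apply: nirr; split=> // d d1 dp.
  by apply/negPn/negP => ndp; apply: H; exists d.
have lt_d : (size d < size p)%N.
  by rewrite ltn_neqAle dvdp_leq // andbT; rewrite dvdp_size_eqp.
have d2 : (1 < size d)%N.
  by rewrite ltn_neqAle eq_sym d1 size_poly_gt0 (dvdpN0 dp).
have [h irr hd] := IHn d (leq_trans lt_d le_p) d2.
by exists h => //; apply: dvdp_trans hd dp.
Qed.

Lemma dvdp_irreducible (F : fieldType) (h p : {poly F}) :
  irreducible_poly h -> ~~ coprimep h p -> h %| p.
Proof.
move=> [_ irr]; rewrite /coprimep => nco.
have := irr _ nco (dvdp_gcdl h p); rewrite /eqp => /andP[_ hg].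
exact: dvdp_trans hg (dvdp_gcdr h p).
Qed.

(** Irreducible factors are split off one at a time. A root of such a factor [h] in an extension is
    an m-th root of unity, so h divides X^m - 1; simplicity makes h coprime to the cofactor, and the
    exponents multiply. *)
Lemma dvdp_Xnsub1_of_simple_unity_roots (F : fieldType) (Q : {poly F}) :
  Q != 0 ->
  (forall (L : fieldType) (f : {rmorphism F -> L}) (z : L),
     root (map_poly f Q) z ->
     mup z (map_poly f Q) = 1%N /\ exists2 n, (0 < n)%N & n.-unity_root z) ->
  exists2 N, (0 < N)%N & Q %| 'X^N - 1.
Proof.
move=> Q0 QP.
(* The induction runs over the divisors of [Q], since the hypothesis on roots concerns [Q]
   itself. *)
suff H Q' : Q' %| Q -> exists2 N, (0 < N)%N & Q' %| 'X^N - 1 by apply: H.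
have [n] := ubnP (size Q'); elim: n Q' => // n IHn Q' le_Q' Q'Q.
have Q'0 : Q' != 0 := dvdpN0 Q'Q Q0.
have [szQ'|] := leqP (size Q') 1.
  exists 1%N => //; have : size Q' == 1%N by rewrite eqn_leq szQ' size_poly_gt0.
  by rewrite size_poly_eq1 => /eqp_dvdl ->; rewrite dvd1p.
move=> /exists_irreducible_factor[h irr hQ'].
have [L _ [z hz _]] := irredp_FAdjoin irr.
pose f : {rmorphism F -> L} := in_alg L.
have hQ : h %| Q := dvdp_trans hQ' Q'Q.
have Qz : root (map_poly f Q) z.
  by apply: root_dvdp hz; rewrite dvdp_map.
have [mupz [m m0 mz]] := QP L f z Qz.
have hm : h %| 'X^m - 1.
  apply: dvdp_irreducible => //; rewrite -(coprimep_map f).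
  apply/negP => /coprimep_root /(_ hz) /negP; apply.
  rewrite rmorphB /= map_polyXn rmorph1.
  by move: mz; rewrite /root_of_unity.
have Q'E : Q' = Q' %/ h * h by rewrite divpK.
set Q'' := Q' %/ h in Q'E.
have Q''0 : Q'' != 0 by apply: contraNneq Q'0; rewrite Q'E => ->; rewrite mul0r.
have [h1 _] := irr.
have [||N N0 Q''N] := IHn Q''.
- rewrite -ltnS; apply: leq_trans le_Q'; rewrite ltnS Q'E size_mul ?(irredp_neq0 irr) //.
  by move: h1; case: (size h) => [|[|k]] // _; rewrite !addnS /= ltnS leq_addr.
- by apply: dvdp_trans _ Q'Q; rewrite Q'E dvdp_mulr.
exists (m * N)%N; first by rewrite muln_gt0 m0.
rewrite Q'E Gauss_dvdp.
  rewrite (dvdp_trans hm (dvdp_Xnsub1 _ _ _)) andbT mulnC.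
  by rewrite (dvdp_trans Q''N (dvdp_Xnsub1 _ _ _)).
rewrite coprimep_sym; apply/negPn/negP => /(dvdp_irreducible irr) hQ''.
(* If h also divided the cofactor, h^2 would divide [Q] and z would be a multiple root. *)
have : (2 <= mup z (map_poly f Q))%N.
  rewrite mup_geq ?map_poly_eq0 //.
  apply: (@dvdp_trans _ (map_poly f (h * h))).
    by rewrite rmorphM /= expr2 dvdp_mul // dvdp_XsubCl.
  rewrite dvdp_map; apply: dvdp_trans _ Q'Q; rewrite Q'E.
  by rewrite dvdp_mul2r ?irredp_neq0.
by rewrite mupz.
Qed.

(** A double root would be a root of the derivative N X^(N-1), hence zero, and zero is no root of
    X^N - 1. *)
Lemma mup_Xnsub1_le1 (F : fieldType) (p : {poly F}) N (z : F) :
  N%:R != 0 :> F -> p %| 'X^N - 1 -> (mup z p <= 1)%N.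
Proof.
move=> N0 pN.
have {}N1 : (0 < N)%N by rewrite lt0n; apply: contraNneq N0 => ->.
have p0 : p != 0.
  by apply: dvdpN0 pN _; rewrite -size_poly_gt0 size_Xn_sub_1.
rewrite leqNgt; apply/negP; rewrite mup_geq // => /dvdp_trans/(_ pN)/dvdpP[r].
rewrite expr2 => E.
have zN : z ^+ N = 1.
  have := congr1 (fun q => q.[z]) E; rewrite !hornerM hornerXsubC subrr !mulr0 !(hornerE, hornerXn).
  by move/eqP; rewrite subr_eq0 => /eqP.
have : (('X^N - 1 : {poly F})^`()).[z] = 0.
  have w0 : ('X - z%:P).[z] = 0 by rewrite hornerXsubC subrr.
  by rewrite E !derivM hornerD !hornerM [in X in _ + X]hornerD !hornerM w0 !(mulr0, mul0r, addr0).
rewrite derivB derivXn derivC subr0 hornerMn hornerXn.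
move/eqP; rewrite -mulr_natl mulf_eq0 (negPf N0) /= expf_eq0 => /andP[_ /eqP z0].
by move: zN; rewrite z0 expr0n eqn0Ngt N1 => /esym/eqP; rewrite oner_eq0.
Qed.

Lemma fieldExt_rat_natr_neq0 (K : fieldExtType rat) n : (0 < n)%N -> n%:R != 0 :> K.
Proof. by move=> n0; rewrite -(rmorph_nat (in_alg K)) fmorph_eq0 pnatr_eq0 -lt0n. Qed.

(** The fraction with denominator X^N - 1 is put in lowest terms. The gcd divides X^N - 1, so its
    constant term is nonzero and it can be cancelled in the expansion. *)
Lemma rational_of_periodic (K : fieldExtType rat) (a : nat -> K) N n0 :
  (0 < N)%N -> (forall n, (n0 <= n)%N -> a (n + N)%N = a n) ->
  rational_simple_poles_at_unity_roots a.
Proof.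
move=> N0 /expansion_of_periodic[P0 aP0].
pose Q0 : {poly K} := 'X^N - 1.
have Q00 : Q0 != 0 by rewrite -size_poly_eq0 size_XnsubC.
pose g := gcdp P0 Q0.
have gQ0 : g %| Q0 := dvdp_gcdr _ _.
have g0 : g`_0 != 0.
  rewrite -horner_coef0; apply/negP => /(root_dvdp gQ0) /eqP.
  rewrite !(hornerE, hornerXn) expr0n eqn0Ngt N0 sub0r => /eqP.
  by rewrite oppr_eq0 oner_eq0.
have QQ0 : Q0 %/ g %| Q0 by rewrite -{2}(divpK gQ0) dvdp_mulr.
have Q1 : Q0 %/ g != 0 := dvdpN0 QQ0 Q00.
exists (P0 %/ g), (Q0 %/ g); split=> //.
- by apply: coprimep_div_gcd; rewrite Q00 orbT.
- apply: (expands_to_cancel g0).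
  by rewrite ![g * _]mulrC !divpK ?dvdp_gcdl.
move=> L f z Qz.
have QL : map_poly f (Q0 %/ g) %| 'X^N - 1.
  have -> : 'X^N - 1 = map_poly f Q0 by rewrite rmorphB /= map_polyXn rmorph1.
  by rewrite dvdp_map.
split; last first.
  exists N => //; exact: root_dvdp QL Qz.
apply/eqP; rewrite eqn_leq (@mup_Xnsub1_le1 _ _ N) //=.
  by rewrite mup_geq ?map_poly_eq0 // expr1 dvdp_XsubCl.
by rewrite -(rmorph_nat f) fmorph_eq0 fieldExt_rat_natr_neq0.
Qed.

Lemma rational_simple_poles_periodicP (K : fieldExtType rat) (a : nat -> K) :
  rational_simple_poles_at_unity_roots a <->
  exists n0 N, (0 < N)%N /\ forall n, (n0 <= n)%N -> a (n + N)%N = a n.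
Proof.
split=> [[P [Q [Q0 _ aPQ QP]]]|[n0 [N [N0 aN]]]]; last exact: rational_of_periodic aN.
have [N N0 /dvdpP[U UQ]] := dvdp_Xnsub1_of_simple_unity_roots Q0 QP.
exists (size (U * P)), N; split=> //; apply: periodic_of_expansion.
by rewrite UQ; apply: expands_toM.
Qed.

(** * Valuations *)

Lemma prime_of_ext (K : fieldExtType rat) (p q : prime_of K) :
  (forall x, p x = q x) -> p = q.
Proof.
case: p q => [v v1 v2 v3 v4 v5] [w w1 w2 w3 w4 w5] /= /funext E; subst w.
by congr PrimeOf; apply: Prop_irrelevance.
Qed.

(* Junk value [0] at [x = 0]. *)
Definition vint (K : fieldExtType rat) (p : prime_of K) (x : K) : int := fine (p x).

Section Valuation.
Variables (K : fieldExtType rat) (p : prime_of K).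
Implicit Types x y : K.

Lemma valuation0 : p 0 = +oo%E.
Proof. by apply/eqP; rewrite valuation_eqy. Qed.

Lemma vintE x : x != 0 -> p x = (vint p x)%:E.
Proof.
rewrite /vint; have := valuation_neqNy p x; have := valuation_eqy p x.
by case: (p x) => //= <-.
Qed.

Lemma valuation_lt0_neq0 x : (p x < 0)%E -> x != 0.
Proof. by apply: contraTneq => ->; rewrite valuation0 -leNgt leey. Qed.

Lemma valuation_eq0_neq0 x : p x = 0%E -> x != 0.
Proof. by apply: contra_eqN => /eqP ->; rewrite valuation0. Qed.

Lemma vintM x y : x != 0 -> y != 0 -> vint p (x * y) = vint p x + vint p y.
Proof.
move=> x0 y0; have := valuationM p x y.
by rewrite !vintE ?mulf_neq0 // => -[].
Qed.

Lemma vint1 : vint p 1 = 0.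
Proof. by rewrite /vint valuation1. Qed.

Lemma vintV x : x != 0 -> vint p x^-1 = - vint p x.
Proof.
move=> x0; apply: (addrI (vint p x)); rewrite subrr -vintM ?invr_eq0 //.
by rewrite divff // vint1.
Qed.

Lemma vintX x n : x != 0 -> vint p (x ^+ n) = vint p x *+ n.
Proof.
move=> x0; elim: n => [|n IHn]; first by rewrite expr0 vint1.
by rewrite exprS vintM ?expf_neq0 // IHn mulrS.
Qed.

Lemma vintXz x (n : int) : x != 0 -> vint p (x ^ n) = vint p x * n.
Proof.
case: n => n x0; first by rewrite -exprnP vintX // -mulr_natr natz.
by rewrite NegzE -exprnN vintV ?expf_neq0 // vintX // mulrN -mulr_natr natz.
Qed.

Lemma valuationD_lt x y : (p x < p y)%E -> p (x + y) = p x.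
Proof.
move=> lt_xy; apply/eqP; rewrite eq_le.
have := valuationD p x y; rewrite min_l ?(ltW lt_xy) // => ->; rewrite andbT.
have := valuationD p (x + y) (- y); rewrite addrK valuationN.
by rewrite ge_min (leNgt (p y)) lt_xy orbF.
Qed.

Lemma valuation_sum_gt (m : \bar int) (I : finType) (P : pred I) (F : I -> K) :
  (m < +oo)%E -> (forall i, P i -> (m < p (F i))%E) ->
  (m < p (\sum_(i | P i) F i)%R)%E.
Proof.
move=> m_fin mF; elim/big_ind: _ => [|x y mx my|i Pi]; last exact: mF.
  by rewrite valuation0.
by apply: lt_le_trans (valuationD p x y); rewrite lt_min mx.
Qed.

Lemma sum_neq0_of_dominant (I : finType) (y : I -> K) k :
  y k != 0 -> (forall i, i != k -> (p (y k) < p (y i))%E) -> \sum_i y i != 0.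
Proof.
move=> yk0 dom; rewrite (bigD1 k) //=; apply/negP; rewrite addr_eq0 => /eqP yE.
have : (p (y k) < p (\sum_(i | i != k) y i)%R)%E.
  by apply: valuation_sum_gt => //; rewrite vintE ?ltry.
by rewrite yE valuationN ltxx.
Qed.

Lemma valuation_nat_ge0 n : (0 <= p n%:R)%E.
Proof. exact: (rpred_nat (valuation_integral p) n). Qed.

Lemma valuation_int_ge0 (n : int) : (0 <= p n%:~R)%E.
Proof. exact: (rpred_int (valuation_integral p) n). Qed.

(** If [c] also had positive valuation, a Bezout relation u l + v c = 1 would give 1 positive
    valuation. *)
Lemma valuation_int_unit (l : nat) (c : int) :
  prime l -> (0 < p l%:R)%E -> ~~ (l %| c)%Z -> p c%:~R = 0%E.
Proof.
move=> l_pr pl ndv; apply/eqP; rewrite eq_le valuation_int_ge0 andbT leNgt.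
apply/negP => pc; have : coprimez l c by rewrite /coprimez /gcdz eqz_nat -/(coprime _ _) prime_coprime.
case/coprimezP=> -[u v] /= E.
have : (0 < p (u%:~R * l%:R + v%:~R * c%:~R)%R)%E.
  apply: lt_le_trans (valuationD _ _ _).
  rewrite lt_min !valuationM !(lt_le_trans _ (leeDr _ _)) //; exact: valuation_int_ge0.
by rewrite -[l%:R]/(l%:~R) -!intrM -intrD E valuation1 ltxx.
Qed.

(** The bound on [l] leaves finitely many candidate residue characteristics for the primes at which
    [n] is not a unit. *)
Lemma valuation_nat_prime n : (0 < n)%N -> p n%:R != 0%E ->
  exists l, [/\ prime l, (l <= n)%N & (0 < p l%:R)%E].
Proof.
elim/ltn_ind: n => n IHn n0 pn.
have [n1|] := leqP n 1.
  by move: pn; have -> : n = 1%N by [apply/eqP; rewrite eqn_leq n1]; rewrite valuation1 eqxx.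
move=> n1; have l_pr := pdiv_prime n1; have l1 := prime_gt1 l_pr.
have nE := divnK (pdiv_dvd n).
have m0 : (0 < n %/ pdiv n)%N by rewrite divn_gt0 ?pdiv_gt0 ?pdiv_leq.
have [pl|pl0] := ltP 0%E (p (pdiv n)%:R).
  by exists (pdiv n); split=> //; apply: pdiv_leq.
have {}pl0 : p (pdiv n)%:R = 0%E.
  by apply/eqP; rewrite eq_le pl0 valuation_nat_ge0.
have [||l [l_prime le_l pl]] := IHn (n %/ pdiv n)%N _ m0.
- by rewrite ltn_Pdiv.
- by move: pn; rewrite -{1}nE natrM valuationM pl0 adde0.
by exists l; split=> //; apply: leq_trans le_l (leq_div _ _).
Qed.

End Valuation.

(** * Independence and weak approximation of distinct primes *)

Section Approximation.
Variable K : fieldExtType rat.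
Implicit Types v w : prime_of K.

(** Units for [v] are units for [w], so w = w(pi) v for a uniformizer pi of [v]; since [w] takes the
    value 1, w(pi) = 1. *)
Lemma valuation_ring_maximal v w :
  (forall x, (0 <= v x)%E -> (0 <= w x)%E) -> v = w.
Proof.
move=> H.
have [pi vpi] := valuation_normalized v; have [x wx] := valuation_normalized w.
have pi0 : pi != 0 by apply: contra_eqN vpi => /eqP ->; rewrite valuation0.
have x0 : x != 0 by apply: contra_eqN wx => /eqP ->; rewrite valuation0.
have {}vpi : vint v pi = 1 by rewrite /vint vpi.
have {}wx : vint w x = 1 by rewrite /vint wx.
have H' y : y != 0 -> 0 <= vint v y -> 0 <= vint w y.
  by move=> y0; have := H y; rewrite !vintE // !lee_fin.
have wE y : y != 0 -> vint w y = vint w pi * vint v y.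
  move=> y0; have u0 : y * pi ^ (- vint v y) != 0 by rewrite mulf_neq0 ?expfz_neq0.
  have vu : vint v (y * pi ^ (- vint v y)) = 0.
    by rewrite vintM ?expfz_neq0 // vintXz // vpi mul1r subrr.
  have wu : vint w (y * pi ^ (- vint v y)) = 0.
    apply/eqP; rewrite eq_le H' ?vu // andbT -oppr_ge0 -(vintV _ u0).
    by apply: H'; rewrite ?invr_eq0 // vintV // vu.
  by move: wu; rewrite vintM ?expfz_neq0 // vintXz // mulrN => /eqP; rewrite subr_eq0 => /eqP.
have wpi : vint w pi = 1.
  have := wE x x0; rewrite wx => /esym; have : 0 <= vint w pi by apply: H'; rewrite ?vpi.
  move: (vint w pi) (vint v x) => a b a0 ab; have b0 : 0 < b by nia.
  have : a = 1 \/ 2 <= a by nia.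
  by case=> // a2; nia.
apply: prime_of_ext => y; have [->|y0] := eqVneq y 0; first by rewrite !valuation0.
by rewrite !vintE // wE // wpi mul1r.
Qed.

(** By maximality of the valuation rings, each prime has an integral element that is not integral at
    the other; their quotient separates the two. *)
Lemma separating_element v w : w <> v -> exists z, (v z < 0 /\ 0 < w z)%E.
Proof.
move=> ne_wv.
have sep (v1 v2 : prime_of K) : v1 <> v2 -> exists x, (0 <= v1 x)%E /\ (v2 x < 0)%E.
  move=> ne; apply: contrapT => H; apply: ne; apply: valuation_ring_maximal => x v1x.
  by rewrite leNgt; apply/negP => v2x; apply: H; exists x.
have [x [vx wx]] := sep v w (nesym ne_wv); have [y [wy vy]] := sep w v ne_wv.
have x0 := valuation_lt0_neq0 wx; have y0 := valuation_lt0_neq0 vy.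
exists (y / x); move: vx wx wy vy; rewrite !vintE ?mulf_neq0 ?invr_eq0 //.
rewrite !lee_fin !lte_fin !vintM ?invr_eq0 // !vintV //; lia.
Qed.

(** The new prime is handled by correcting an element [y] that separates it from [v] with a factor
    [t] that is small at the earlier primes and a unit at the new one. *)
Lemma approximation v (w : nat -> prime_of K) n :
  (forall i, (i < n)%N -> w i <> v) ->
  exists z, (v z < 0)%E /\ forall i, (i < n)%N -> (0 < w i z)%E.
Proof.
elim: n => [|n IHn] ne_wv.
  have [pi vpi] := valuation_normalized v.
  have pi0 : pi != 0 by apply: contra_eqN vpi => /eqP ->; rewrite valuation0.
  exists pi^-1; split=> //; rewrite vintE ?invr_eq0 // vintV // lte_fin.
  by rewrite /vint vpi.
have [|z [vz wz]] := IHn; first by move=> i lt_i; apply: ne_wv; apply: ltnW.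
have [y [vy wy]] := separating_element (ne_wv n (ltnSn n)).
have z0 := valuation_lt0_neq0 vz; have y0 := valuation_lt0_neq0 vy.
have [wnz|wnz] := ltP 0%E (w n z).
  exists z; split=> // i; rewrite ltnS leq_eqVlt => /predU1P[->//|]; exact: wz.
(* [r] exceeds every |w_i(y)|, so z^r outweighs the possible poles of [y] at the earlier primes. *)
pose r := (\sum_(i < n) `|vint (w i) y|%N).+1.
have vzr : vint v (z ^+ r) < 0.
  move: vz; rewrite vintE // lte_fin vintX // -mulr_natr => vz.
  by rewrite pmulr_llt0 // ltr0n.
have wzr i : (i < n)%N -> 0 < vint (w i) (z ^+ r) /\ 0 < vint (w i) (z ^+ r) + vint (w i) y.
  move=> lt_i; have := wz i lt_i; rewrite vintE // lte_fin vintX // -mulr_natr.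
  have : (`|vint (w i) y| < r)%N.
    by rewrite ltnS (bigD1 (Ordinal lt_i)) //= leq_addr.
  rewrite natz; move: (vint _ y) (vint _ z) => a b; nia.
have zr0 : z ^+ r != 0 by rewrite expf_neq0.
(* Take t = z^r if [z] is a unit at w_n, and t = z^r / (z^r + 1) if it has a pole there. In the
   quotient the denominator is a unit at the earlier primes and has the valuation of z^r at [v] and
   w_n. *)
have [t [t0 vt wt wnt]] : exists t, [/\ t != 0, vint v t <= 0,
    (forall i, (i < n)%N -> vint (w i) t = vint (w i) (z ^+ r)) & vint (w n) t = 0].
  move: wnz; rewrite vintE // lee_fin le_eqVlt => /predU1P[wnz|wnz].
    by exists (z ^+ r); split; rewrite ?(ltW vzr) // vintX // wnz mul0rn.
  have wnzr : vint (w n) (z ^+ r) < 0.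
    by rewrite vintX // -mulr_natr pmulr_llt0 // ltr0n.
  have neg (u : prime_of K) : vint u (z ^+ r) < 0 -> u (z ^+ r + 1) = u (z ^+ r).
    by move=> lt0; apply: valuationD_lt; rewrite valuation1 vintE // lte_fin.
  have d0 : z ^+ r + 1 != 0.
    by rewrite -(valuation_eqy v) (neg _ vzr) vintE.
  exists (z ^+ r / (z ^+ r + 1)); split.
  - by rewrite mulf_neq0 ?invr_eq0.
  - by rewrite vintM ?invr_eq0 // vintV // {2}/vint neg // subrr.
  - move=> i /wzr[lt0 _]; rewrite vintM ?invr_eq0 // vintV //.
    have -> : vint (w i) (z ^+ r + 1) = 0.
      by rewrite /vint addrC valuationD_lt valuation1 // vintE // lte_fin.
    by rewrite subr0.
  - by rewrite vintM ?invr_eq0 // vintV // {2}/vint neg // subrr.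
exists (t * y); rewrite vintE ?mulf_neq0 // vintM // lte_fin; split.
  by move: vy; rewrite vintE // lte_fin; lia.
move=> i; rewrite ltnS leq_eqVlt vintE ?mulf_neq0 // vintM // lte_fin => /predU1P[->|lt_i].
  by move: wy; rewrite wnt add0r vintE.
by rewrite wt //; case: (wzr i lt_i).
Qed.

End Approximation.

(** * Primitive integer relations and finiteness of exceptional primes *)

Lemma primitive_int_relation (K : fieldExtType rat) n (x : 'I_n -> K) (c : 'I_n -> int) :
  (exists i, c i != 0) -> \sum_i (c i)%:~R * x i = 0 ->
  exists b : 'I_n -> int, \sum_i (b i)%:~R * x i = 0 /\
    forall l : nat, (1 < l)%N -> exists i, ~~ (l %| b i)%Z.
Proof.
have [m] := ubnP (\sum_i `|c i|)%N; elim: m c => // m IHm c; rewrite ltnS.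
move=> le_m [i0 ci0] cx.
have [prim|] := pselect (forall l : nat, (1 < l)%N -> exists i, ~~ (l %| c i)%Z).
  by exists c.
move=> /existsNP[l /not_implyP[l1 /forallNP nprim]].
have cE i : c i = (c i %/ l)%Z * l.
  by rewrite divzK //; apply/negPn/negP; apply: nprim.
have l0 : l%:~R != 0 :> K.
  by rewrite -[l%:~R]/(l%:R) -(rmorph_nat (in_alg K)) fmorph_eq0 pnatr_eq0 -lt0n ltnW.
(* Dividing out the common factor [l] lowers the sum of the absolute values, which bounds the
   descent. *)
apply: (IHm (fun i => (c i %/ l)%Z)).
- apply: leq_trans le_m; rewrite (bigD1 i0) // [X in (_ < X)%N](bigD1 i0) //=.
  rewrite -addSn leq_add //; first by move: (cE i0) ci0 l1; nia.
  by apply: leq_sum => i _; move: (cE i) l1; nia.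
- by exists i0; apply: contraNneq ci0 => E; rewrite cE E mul0r.
- apply: (mulIf l0); rewrite mul0r -[RHS]cx mulr_suml; apply: eq_bigr => i _.
  by rewrite [in RHS]cE intrM mulrAC.
Qed.

(** More elements than the degree are dependent over the rationals; clear denominators. Primitivity
    keeps the relation nontrivial modulo every prime. *)
Lemma int_relation (K : fieldExtType rat) n (x : 'I_n -> K) :
  (\dim {:K} < n)%N ->
  exists c : 'I_n -> int, \sum_i (c i)%:~R * x i = 0 /\
    forall l : nat, (1 < l)%N -> exists i, ~~ (l %| c i)%Z.
Proof.
move=> lt_n; have : ~~ free [tuple x i | i < n].
  apply/negP => fx; have := dimvS (subvf <<[tuple x i | i < n]>>%VS).
  by rewrite (eqP fx) size_tuple leqNgt lt_n.
move=> /freeP/existsNP[k /not_implyP[kx /existsNP[i0 /eqP ki0]]].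
pose D := \prod_i denq (k i).
have D0 : D != 0 by apply/prodf_neq0 => i _; rewrite denq_neq0.
pose c i : int := numq (k i) * \prod_(j | j != i) denq (k j).
have cE i : (c i)%:~R = k i * D%:~R.
  by rewrite /D (bigD1 i) //= !intrM mulrA numqE.
apply: (@primitive_int_relation _ _ _ c).
  exists i0; rewrite -(intr_eq0 rat) cE mulf_neq0 ?intr_eq0 //.
have cK i : (c i)%:~R = (k i * D%:~R)%:A :> K by rewrite -cE -[RHS]/(in_alg K _) rmorph_int.
rewrite -[RHS](scaler0 _ D%:~R) -[in RHS]kx scaler_sumr; apply: eq_bigr => i _.
by rewrite cK mulr_algl scalerA mulrC (nth_map i) ?size_enum_ord // -tnth_nth tnth_ord_tuple.
Qed.

(** [x] is a root of an integer polynomial. If its lowest and highest nonzero coefficients are units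
    at [p], then [x] is one too: otherwise one of these two terms has strictly smallest valuation
    and the sum cannot vanish. [N] is the product of their absolute values. *)
Lemma valuation_unit_bound (K : fieldExtType rat) (x : K) : x != 0 ->
  exists2 N, (0 < N)%N & forall p : prime_of K, p x != 0%E -> p N%:R != 0%E.
Proof.
move=> x0; pose d := (\dim {:K}).
have [c [cx cprim]] := int_relation (fun i : 'I_d.+1 => x ^+ i) (ltnSn d).
have [i ci] : exists i, c i != 0.
  by have [i ndv] := cprim 2 isT; exists i; apply: contraNneq ndv => ->.
case: (@arg_minnP _ i (fun i => c i != 0) (fun i => nat_of_ord i) ci) => u cu umin.
case: (@arg_maxnP _ i (fun i => c i != 0) (fun i => nat_of_ord i) ci) => v cv vmax.
have intrK0 (n : int) : n != 0 -> n%:~R != 0 :> K.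
  by move=> n0; rewrite -(rmorph_int (in_alg K)) fmorph_eq0 intr_eq0.
exists (`|c u| * `|c v|)%N; first by rewrite muln_gt0 !absz_gt0 cu.
move=> p; apply: contra => /eqP pN.
have absE n : p (`|n|%N)%:R = p n%:~R.
  by case: n => n //; rewrite NegzE mulrNz valuationN.
have pu_v : (p (c u)%:~R = 0 /\ p (c v)%:~R = 0)%E.
  move: pN; rewrite natrM valuationM !absE.
  have := valuation_int_ge0 p (c u); have := valuation_int_ge0 p (c v).
  rewrite !vintE ?intrK0 // !lee_fin => h1 h2 [h3].
  have : vint p (c u)%:~R = 0 /\ vint p (c v)%:~R = 0 by lia.
  by case=> -> ->.
case: pu_v => pu pv.
have term j : c j != 0 -> p ((c j)%:~R * x ^+ j) = (vint p (c j)%:~R + vint p x *+ j)%:E.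
  by move=> cj; rewrite vintE ?mulf_neq0 ?expf_neq0 ?intrK0 // vintM ?expf_neq0 ?intrK0 // vintX.
have vu : vint p (c u)%:~R = 0 by rewrite /vint pu.
have vv : vint p (c v)%:~R = 0 by rewrite /vint pv.
have dom k : c k != 0 -> vint p (c k)%:~R = 0 ->
    ~ (forall j, c j != 0 -> j != k -> vint p x *+ k < vint p x *+ j).
  move=> ck vk H; have := @sum_neq0_of_dominant _ p _ (fun j => (c j)%:~R * x ^+ (j : nat)) k.
  rewrite cx eqxx => F; suff: false by []; apply: F.
    by rewrite mulf_neq0 ?expf_neq0 ?intrK0.
  move=> j ne_jk; rewrite (term k) // vk add0r.
  have [cj|cj] := eqVneq (c j) 0; first by rewrite cj mul0r valuation0 ltry.
  rewrite term // lte_fin; apply: lt_le_trans (H j cj ne_jk) _.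
  by rewrite lerDr; have := valuation_int_ge0 p (c j); rewrite vintE ?intrK0.
rewrite vintE //; apply/eqP; congr EFin; apply/eqP; rewrite eq_le.
apply/andP; split; rewrite leNgt; apply/negP => vx.
- apply: (dom u cu vu) => j cj ne; rewrite ltr_pMn2l //.
  by rewrite ltn_neqAle umin // andbT eq_sym; apply: contraNneq ne => /val_inj ->.
- apply: (dom v cv vv) => j cj ne; rewrite ltr_nMn2l //.
  rewrite ltn_neqAle; apply/andP; split; last exact: vmax.
  by apply: contraNneq ne => /val_inj ->.
Qed.

(** Given d + 1 primes over [l], with d the degree, choose for each an element with a pole there and
    positive valuation at the others. A primitive relation between them has a coefficient prime to
    [l], and at the corresponding prime that term dominates, a contradiction. *)
Lemma finite_primes_over (K : fieldExtType rat) l : prime l ->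
  finite_set [set p : prime_of K | (0 < p l%:R)%E].
Proof.
move=> l_pr; apply: contrapT => /infiniteP/card_leP[f0].
pose f n := \val (f0 (SigSub (mem_set (I : [set: nat]%classic n)))).
have finj : injective f.
  by move=> i j /val_inj/inj; rewrite !inE => /(_ I I)/(congr1 val).
have fl i : (0 < f i l%:R)%E := set_valP (f0 _).
pose d := (\dim {:K}).
have /fin_all_exists[z zP] : forall k : 'I_d.+1, exists z, (f k z < 0)%E /\
    forall i : 'I_d.+1, i != k -> (0 < f i z)%E.
  (* [bump k] enumerates the d indices other than k. *)
  move=> k; have [|z [vz wz]] := @approximation K (f k) (fun i => f (bump k i)) d.
    by move=> i _ /finj/eqP; rewrite eq_sym (negPf (neq_bump _ _)).
  exists z; split=> // i ne_ik.
  have := wz (unbump k i); rewrite unbumpKcond [val i == _](negPf ne_ik).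
  apply; have ne_val : val i != val k := ne_ik; rewrite /unbump.
  by case: ltnP (ltn_ord i) (ltn_ord k) ne_val => /=; lia.
have [c [cz cprim]] := int_relation z (ltnSn d).
have [k ck] := cprim l (prime_gt1 l_pr).
have pck := valuation_int_unit l_pr (fl k) ck.
have pzk := (zP k).1.
have := @sum_neq0_of_dominant _ (f k) _ (fun i => (c i)%:~R * z i) k.
rewrite cz eqxx => F; suff: false by []; apply: F.
  by rewrite mulf_neq0 ?(valuation_eq0_neq0 pck) ?(valuation_lt0_neq0 pzk).
move=> i ne_ik; rewrite !valuationM pck add0e (lt_trans pzk) //.
apply: lt_le_trans (leeDr _ (valuation_int_ge0 (f k) (c i))).
by apply: (zP i).2; rewrite eq_sym.
Qed.

(** The primes at which [x] is not a unit lie over the rational primes up to [N], with finitely many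
    over each. *)
Lemma exists_prime_unit (K : fieldExtType rat) (A : set (prime_of K)) (x : K) :
  infinite_set A -> x != 0 -> exists p, A p /\ p x = 0%E.
Proof.
move=> infA /valuation_unit_bound[N N0 NP]; apply: contrapT => H; apply: infA.
pose F l := [set p : prime_of K | prime l /\ (0 < p l%:R)%E]%classic.
apply: (@sub_finite_set _ _ (\bigcup_(l in `I_N.+1) F l)%classic).
  move=> p Ap; have px : p x != 0%E by apply/eqP => px; apply: H; exists p.
  have [l [l_pr le_l pl]] := valuation_nat_prime N0 (NP p px).
  by exists l.
apply: bigcup_finite; first exact: finite_II.
move=> l _; have [l_pr|nl] := boolP (prime l).
  by apply: sub_finite_set (finite_primes_over K l_pr) => p [].
by apply: sub_finite_set (finite_set0 _) => p [l_pr]; rewrite l_pr in nl.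
Qed.

(** A uniformizer is not a unit, so some positive integer is not a unit at [p]. *)
Lemma exists_residue_char (K : fieldExtType rat) (p : prime_of K) :
  exists2 l, prime l & (0 < p l%:R)%E.
Proof.
have [pi vpi] := valuation_normalized p.
have pi0 : pi != 0 by apply: contra_eqN vpi => /eqP ->; rewrite valuation0.
have [N N0 NP] := valuation_unit_bound pi0.
have [|l [l_pr _ pl]] := valuation_nat_prime N0 (NP p _); first by rewrite vpi.
by exists l.
Qed.

(** * Residue fields *)

Lemma residue_eq (K : fieldExtType rat) (p : prime_of K) (x y : valuation_ring p) :
  (\pi_(residue_field p)%qT x == \pi_(residue_field p)%qT y) =
  (0 < p (val x - val y)%R)%E.
Proof. by rewrite -(Quotient.idealrBE (max_ideal (p:=p) : idealr _)). Qed.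

Lemma residue_eq0 (K : fieldExtType rat) (p : prime_of K) (x : valuation_ring p) :
  (\pi_(residue_field p)%qT x == 0) = (0 < p (val x))%E.
Proof.
have -> : 0 = \pi_(residue_field p)%qT 0 :> residue_field p by rewrite rmorph0.
by rewrite residue_eq subr0.
Qed.

Section ResidueCard.
Variables (K : fieldExtType rat) (p : prime_of K) (l : nat).
Hypotheses (l_pr : prime l) (pl : (0 < p l%:R)%E).

(** Linear independence over the field with [l] elements, integers standing for their classes modulo
    [l]. *)
Definition residue_free n (e : 'I_n -> residue_field p) :=
  forall c : 'I_n -> int, \sum_i e i *~ c i = 0 -> forall i, (l %| c i)%Z.

Lemma residue_char (r : residue_field p) (c : int) : (l %| c)%Z -> r *~ c = 0.
Proof.
move=> /dvdzP[d ->]; rewrite mulrC mulrzA; suff -> : r *~ l = 0 by rewrite mul0rz.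
rewrite -mulrzl -[r]reprK; apply/eqP.
have -> : (l%:~R : residue_field p) = \pi_(residue_field p)%qT (l%:R).
  by rewrite rmorph_nat.
rewrite -rmorphM residue_eq0 rmorphM valuationM rmorph_nat.
by apply: lt_le_trans pl (leeDl _ (valP (repr r))).
Qed.

(** Lifts of too many residues satisfy a primitive integer relation, whose reduction is a nontrivial
    relation modulo [l]. *)
Lemma residue_free_leq n (e : 'I_n -> residue_field p) :
  residue_free e -> (n <= \dim {:K})%N.
Proof.
move=> free_e; rewrite leqNgt; apply/negP => lt_n.
have [c [cx cprim]] := int_relation (fun i => val (repr (e i))) lt_n.
have [i ci] := cprim l (prime_gt1 l_pr); apply/negP: ci; rewrite negbK.
apply: free_e; have -> : \sum_i e i *~ c i =
    \pi_(residue_field p)%qT (\sum_i repr (e i) *~ c i).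
  by rewrite rmorph_sum; apply: eq_bigr => j _; rewrite rmorphMz /= reprK.
apply/eqP; rewrite residue_eq0 rmorph_sum (eq_bigr (fun i => (c i)%:~R * val (repr (e i)))).
  by rewrite cx valuation0 ltry.
by move=> j _; rewrite rmorphMz mulrzl.
Qed.

Definition residue_comb n (e : 'I_n -> residue_field p) (c : {ffun 'I_n -> 'I_l}) :=
  \sum_i e i *~ (c i : nat).

Lemma residue_comb_inj n (e : 'I_n -> residue_field p) :
  residue_free e -> injective (residue_comb e).
Proof.
move=> free_e c c' /eqP; rewrite -subr_eq0 /residue_comb -sumrB.
under eq_bigr do rewrite -mulrzBr.
move=> /eqP/free_e dv; apply/ffunP => i; apply: val_inj => /=.
have := dv i; rewrite -eqz_mod_dvd => /eqP.
by rewrite !modz_small /= ?ltz_nat ?ltn_ord // => -[].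
Qed.

(** Adjoining [r] to a maximal free family creates a relation. Its coefficient at [r] is prime to
    [l], as the family is free, and is inverted modulo [l] by Bezout. *)
Lemma residue_comb_surj n (e : 'I_n -> residue_field p) :
  residue_free e -> (forall m (e' : 'I_m -> residue_field p), residue_free e' -> (m <= n)%N) ->
  forall r, exists c, residue_comb e c = r.
Proof.
move=> free_e max_n r.
pose e' (i : 'I_n.+1) := if unlift ord_max i is Some j then e j else r.
have /existsNP[c /not_implyP[c0 /existsNP[i0 /negP ci0]]] : ~ residue_free e'.
  by move=> /max_n; rewrite ltnn.
have sumE : \sum_i e' i *~ c i = \sum_i e i *~ c (lift ord_max i) + r *~ c ord_max.
  rewrite big_ord_recr /= /e' unlift_none; congr (_ + _); apply: eq_bigr => i _.
  have -> : widen_ord (leqnSn n) i = lift ord_max i by apply: val_inj; exact: esym (lift_max i).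
  by rewrite liftK.
have ndv : ~~ (l %| c ord_max)%Z.
  apply/negP => dv; move: c0; rewrite sumE (residue_char _ dv) addr0 => /free_e H.
  case: (unliftP ord_max i0) ci0 => [j ->|->]; by rewrite ?H ?dv.
have /coprimezP[[u v] /= uv] : coprimez (c ord_max) l.
  by rewrite coprimez_sym /coprimez /gcdz eqz_nat -/(coprime _ _) prime_coprime.
have l0 : (0 < l)%N := prime_gt0 l_pr.
have lt_mod (i : int) : (`|(i %% l)%Z| < l)%N.
  by have := ltz_pmod i (d := l); have := modz_ge0 i (d := l); lia.
exists [ffun i => Ordinal (lt_mod (- u * c (lift ord_max i))%R)].
have -> : r = r *~ (u * c ord_max).
  rewrite -[LHS]mulr1z -uv mulrzDr [in X in _ + X]residue_char ?addr0 //.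
  by rewrite dvdz_mull.
move: c0; rewrite sumE => /eqP; rewrite addr_eq0 => /eqP c0.
rewrite mulrC mulrzA -[r *~ _]opprK -c0 mulNrz -mulrNz -[_ *~ - u]mulrzl mulr_sumr.
apply: eq_bigr => i _; rewrite ffunE /= mulrzl -mulrzA.
apply/eqP; rewrite -subr_eq0 -mulrzBr residue_char //.
rewrite gez0_abs; last by apply: modz_ge0; rewrite eqz_nat -lt0n.
by rewrite -eqz_mod_dvd modz_mod mulrC.
Qed.

(** A maximal free family is a basis over the field with [l] elements, so residues correspond to
    coordinate vectors. An empty basis would force 0 = 1. *)
Lemma residue_card_prime_power : exists2 m, (0 < m)%N & residue_card p = (l ^ m)%N.
Proof.
have ex : exists n, `[< exists e : 'I_n -> residue_field p, residue_free e >].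
  exists 0%N; apply/asboolP; exists (fun _ => 0) => c _ [i lt_i]; by [].
have bd n : `[< exists e : 'I_n -> residue_field p, residue_free e >] -> (n <= \dim {:K})%N.
  by move=> /asboolP[e]; apply: residue_free_leq.
case: (ex_maxnP ex bd) => n /asboolP[e free_e] max_n.
have comb_inj := residue_comb_inj free_e.
have comb_surj := residue_comb_surj free_e
  (fun m e' fe' => max_n m (asboolT (ex_intro _ e' fe'))).
exists n.
  rewrite lt0n; apply/eqP => n0; subst n.
  have [c0 E0] := comb_surj 0; have [c1 E1] := comb_surj 1.
  have /eqP := oner_neq0 (residue_field p); apply; rewrite -E0 -E1.
  by congr residue_comb; apply/ffunP => -[].
pose s := [seq residue_comb e c | c : {ffun 'I_n -> 'I_l}].
have s_all r : r \in s by have [c <-] := comb_surj r; rewrite map_f ?mem_enum.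
(* Finiteness comes first, because [fset_set] takes a default value on infinite sets. *)
have fin : finite_set [set: residue_field p].
  by apply: sub_finite_set (finite_seq s) => r _; apply: s_all.
have -> : residue_card p = size s.
  rewrite /residue_card; apply: perm_size; apply: uniq_perm => //.
    by rewrite map_inj_uniq ?enum_uniq.
  by move=> r; rewrite in_fset_set // s_all in_setT.
by rewrite size_map -cardE card_ffun !card_ord.
Qed.
End ResidueCard.

(** * Reductions *)

(** The product x y may be a unit where neither factor is. The integers [M] and [N] have nonnegative
    valuations, so where M N is a unit both are. *)
Lemma exists_prime_unit2 (K : fieldExtType rat) (A : set (prime_of K)) (x y : K) :
  infinite_set A -> x != 0 -> y != 0 -> exists p, [/\ A p, p x = 0%E & p y = 0%E].
Proof.
move=> infA /valuation_unit_bound[M M0 xM] /valuation_unit_bound[N N0 yN].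
have [|p [Ap pMN]] := exists_prime_unit (x := (M * N)%:R) infA.
  by rewrite -(rmorph_nat (in_alg K)) fmorph_eq0 pnatr_eq0 muln_eq0 negb_or -!lt0n M0.
have [pM pN] : p M%:R = 0%E /\ p N%:R = 0%E.
  move: pMN; rewrite natrM valuationM => /eqP.
  rewrite padde_eq0 ?valuation_nat_ge0 // => /andP[/eqP -> /eqP ->]; by [].
exists p; split=> //; apply/eqP/negPn/negP; [move/xM|move/yN].
  by rewrite pM eqxx.
by rewrite pN eqxx.
Qed.

Lemma reduction_eqP (K : fieldExtType rat) (p : prime_of K) (a : nat -> K)
    (ha : forall n, (0 <= p (a n))%E) m n :
  reduction ha m = reduction ha n <-> (0 < p (a m - a n)%R)%E.
Proof. by rewrite -(residue_eq (ValuationRing (ha m)) (ValuationRing (ha n))); apply: rwP eqP. Qed.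

(** For distinct entries this is, up to sign, the discriminant of the polynomial with roots [s]. *)
Definition difference_product (R : comNzRingType) (s : seq R) : R :=
  \prod_(u <- [seq (y, z) | y <- s, z <- s] | u.1 != u.2) (u.1 - u.2).

Lemma difference_product_neq0 (R : idomainType) (s : seq R) : difference_product s != 0.
Proof. by rewrite prodf_seq_neq0; apply/allP => u _; rewrite subr_eq0; apply/implyP. Qed.

(** For distinct x and y, x - y is a factor of a unit whose other factors are integral, so its
    valuation is not positive. *)
Lemma eq_of_difference_product_unit (K : fieldExtType rat) (p : prime_of K) (s : seq K) x y :
  p (difference_product s) = 0%E -> (forall z, z \in s -> (0 <= p z)%E) ->
  x \in s -> y \in s -> (0 < p (x - y)%R)%E -> x = y.
Proof.
move=> ps s_ge0 xs ys; apply: contraTeq => ne_xy; rewrite -leNgt -ps.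
have sub_ge0 z t : z \in s -> t \in s -> z - t \in valuation_integral p.
  by move=> zs ts; apply: rpredB; apply: s_ge0.
rewrite /difference_product (big_rem (x, y)) /=; last by apply/allpairsP; exists (x, y).
rewrite ne_xy valuationM; apply: leeDl.
rewrite big_seq_cond -[(0 <= _)%E]/(_ \in valuation_integral p).
apply: rpred_prod => -[z t].
by move=> /andP[/mem_rem/allpairsP[[z' t'] /= [? ? [-> ->]]] _]; apply: sub_ge0.
Qed.

Lemma residue_card_gt1 (K : fieldExtType rat) (p : prime_of K) : (1 < residue_card p)%N.
Proof.
have [l l_pr pl] := exists_residue_char p.
have [m m0 ->] := residue_card_prime_power l_pr pl.
by rewrite -(exp1n m) ltn_exp2r // prime_gt1.
Qed.

(** Equal powers would make [l] the residue characteristic of [q], where it is a unit. *)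
Lemma residue_card_indep (K : fieldExtType rat) (p q : prime_of K) l i j :
  prime l -> (0 < p l%:R)%E -> q l%:R = 0%E -> (0 < i)%N -> (0 < j)%N ->
  (residue_card p ^ i != residue_card q ^ j)%N.
Proof.
move=> l_pr pl ql i0 j0; have [k k_pr qk] := exists_residue_char q.
have [m m0 ->] := residue_card_prime_power l_pr pl.
have [n n0 ->] := residue_card_prime_power k_pr qk.
rewrite -!expnM; apply: contraTneq qk => E.
have : (l %| k ^ (n * j))%N by rewrite -E dvdn_exp // muln_gt0 m0.
by rewrite Euclid_dvdX // muln_gt0 n0 j0 /= andbT dvdn_prime2 // => /eqP <-; rewrite ql ltxx.
Qed.

(** Among C + 1 distinct values, two share a state of the automaton at a prime that keeps all of
    them distinct. *)
Lemma finite_range_of_bounded (K : fieldExtType rat) (a : nat -> K) C :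
  infinite_set [set p : prime_of K | forall n, (0 <= p (a n))%E] ->
  (forall (p : prime_of K) (ha : forall n, (0 <= p (a n))%E),
     (nb_states_fwd (residue_card p) (reduction ha) <= C%:Z%:E)%E) ->
  finite_set (range a).
Proof.
move=> inf_p bound; apply: contrapT => /(infinite_set_fset C.+1)[B subB ltC].
have /choice[i iP] (y : B) : exists n, a n = val y.
  by have [n _ <-] := subB _ (valP y); exists n.
have [p [ha px]] := exists_prime_unit inf_p (difference_product_neq0 B).
have [S [s [out [leC outE _]]]] := forward_states (residue_card_gt1 p) (bound p ha).
have [|y [z [/eqP ne_yz eq_s]]] := @noninjective_of_card_lt B S (s \o i).
  by rewrite -cardfE; apply: leq_trans ltC.
apply: ne_yz; apply: val_inj; apply: (eq_of_difference_product_unit px).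
- by move=> u /subB[n _ <-]; apply: ha.
- exact: valP.
- exact: valP.
by rewrite -!iP -(reduction_eqP ha) !outE; congr out.
Qed.

Lemma periodic_of_bounded (K : fieldExtType rat) (a : nat -> K) C :
  infinite_set [set p : prime_of K | forall n, (0 <= p (a n))%E] ->
  (forall (p : prime_of K) (ha : forall n, (0 <= p (a n))%E),
     (nb_states_fwd (residue_card p) (reduction ha) <= C%:Z%:E)%E) ->
  exists n0 N, (0 < N)%N /\ forall n, (n0 <= n)%N -> a (n + N)%N = a n.
Proof.
move=> inf_p bound; have /finite_seqP[s rangeE] := finite_range_of_bounded inf_p bound.
have a_s n : a n \in s.
  by have : range a (a n) by [exists n]; rewrite rangeE.
have s_a z : z \in s -> exists n, a n = z.
  move=> zs; have : [set` s]%classic z by []; by rewrite -rangeE => -[n _ <-]; exists n.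
(* Reduction at such a prime is injective on the range of [a], so the block property of the reduced
   sequence lifts to [a]. *)
have blocks (p : prime_of K) : (forall n, (0 <= p (a n))%E) -> p (difference_product s) = 0%E ->
    exists (S : finType) (t : nat -> S),
      forall m, determines_blocks t a (residue_card p ^ m).
  move=> ha px.
  have [S [t [_ [_ _ tP]]]] := forward_states (residue_card_gt1 p) (bound p ha).
  exists S, t => m x y r eq_t lt_r.
  apply: (eq_of_difference_product_unit px) => //.
    by move=> z /s_a[n <-]; apply: ha.
  by rewrite -(reduction_eqP ha); apply: tP.
have ds0 := difference_product_neq0 s.
have [p [pa px]] := exists_prime_unit inf_p ds0.
have [l l_pr pl] := exists_residue_char p.
have l0 : l%:R != 0 :> K by apply: fieldExt_rat_natr_neq0; apply: prime_gt0.
(* Asking that [l] be a unit at q gives q another residue characteristic than p. *)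
have [q [qa qx ql]] := exists_prime_unit2 inf_p ds0 l0.
have [Sp [sp spP]] := blocks p pa px; have [Sq [sq sqP]] := blocks q qa qx.
apply: (cobham (residue_card_gt1 p) (residue_card_gt1 q) _ spP sqP) => i j.
exact: residue_card_indep l_pr pl ql.
Qed.

Theorem theorem3p10 (K : fieldExtType rat) (a : nat -> K)
    (hdef : infinite_set [set p : prime_of K | forall n, (0 <= p (a n))%E]) :
  (exists C : nat, forall (p : prime_of K) (ha : forall n, (0 <= p (a n))%E),
      (nb_states (residue_card p) (reduction ha) <= C%:Z%:E)%E /\
      (nb_states_fwd (residue_card p) (reduction ha) <= C%:Z%:E)%E) <->
  rational_simple_poles_at_unity_roots a.
Proof.
split=> [[C bound]|/rational_simple_poles_periodicP[n0 [N [N0 aN]]]].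
  apply/rational_simple_poles_periodicP; apply: (@periodic_of_bounded _ _ C hdef) => p ha.
  by have [] := bound p ha.
(* This is the bound for reverse reading; it dominates the bound n0 + N for forward reading. *)
exists ((n0 + N) * (n0 + N))%N => p ha.
have redN n : (n0 <= n)%N -> reduction ha (n + N)%N = reduction ha n.
  by move=> /aN E; rewrite /reduction; congr (\pi_(residue_field p)%qT _); apply: val_inj.
split; first exact: nb_states_periodic.
apply: le_trans (nb_states_fwd_periodic _ N0 redN) _.
by rewrite lee_fin lez_nat leq_pmulr // addn_gt0 N0 orbT.
Qed.
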